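(* For every $n\ge1$, the set of 1-terminal chord diagrams of size $n$ having no top cycle subdiagram equals the set of 1-terminal chord diagrams of size $n$ having neither a top cycle nor a bottom cycle subdiagram, and the cardinality of this set is the Catalan number $C_{n-1}=\frac1n\binom{2n-2}{n-1}$.
   Context: A chord diagram of size $n$ is a perfect matching of $\{1,\dots,2n\}$; chords are ordered pairs $(a,b)$ with $a<b$, $a$ the source and $b$ the sink. A subset of chords is a subdiagram, viewed as a diagram by order-preserving relabelling of endpoints. For chords $c_1=(a_1,b_1)$, $c_2=(a_2,b_2)$ with $a_1<a_2$, they cross if $a_2<b_1<b_2$, and then $c_2$ is a right neighbor of $c_1$. A chord is terminal if it has no right neighbors. A diagram is 1-terminal if no chord other than the last one, in the order of sources, is terminal. For $m\ge3$ there are exactly two diagrams whose undirected intersection graph is a cycle of length $m$ (coinciding for $m=3$): the top cycle $T_m=\{(2i-1,2i+2):1\le i\le m-1\}\cup\{(2,2m-1)\}$ and the bottom cycle $B_m=\{(2i,2i+3):1\le i\le m-2\}\cup\{(1,2m-2),(3,2m)\}$. A ''top cycle (bottom cycle) subdiagram'' is a subdiagram equal, after relabelling, to $T_m$ (resp. $B_m$) for some $m\ge3$. *)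

(* Defs.v *)
From HB Require Import structures.
From mathcomp Require Import all_boot all_order all_algebra.

Set Implicit Arguments.
Unset Strict Implicit.
Unset Printing Implicit Defensive.

(* The endpoints 1, ..., 2n are encoded as the ordinals 0, ..., 2n-1. *)
Definition chord (n : nat) : finType := ('I_(2 * n) * 'I_(2 * n))%type.

Definition source n (c : chord n) : 'I_(2 * n) := c.1.
Definition sink n (c : chord n) : 'I_(2 * n) := c.2.

Definition chord_diagram n (D : {set chord n}) : bool :=
  [forall c in D, source c < sink c] &&
  [forall x : 'I_(2 * n),
     #|[set c in D | (source c == x) || (sink c == x)]| == 1].

Definition right_neighbor n (c1 c2 : chord n) : bool :=
  [&& source c1 < source c2, source c2 < sink c1 & sink c1 < sink c2].

Definition terminal n (D : {set chord n}) (c : chord n) : bool :=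
  (c \in D) && [forall d in D, ~~ right_neighbor c d].

Definition last_chord n (D : {set chord n}) (c : chord n) : bool :=
  (c \in D) && [forall d in D, source d <= source c].

Definition one_terminal n (D : {set chord n}) : bool :=
  [forall c in D, ~~ last_chord D c ==> ~~ terminal D c].

Definition endpoints n (S : {set chord n}) : {set 'I_(2 * n)} :=
  [set source c | c in S] :|: [set sink c | c in S].

(* The new label of x is its rank, starting from 1, among the endpoints of S. *)
Definition relabel_endpoint n (S : {set chord n}) (x : 'I_(2 * n)) : nat :=
  #|[set y in endpoints S | y <= x]|.

(* Relabelled diagrams are duplicate-free lists of pairs of 1-based labels;
   they are compared up to the order of the list, i.e. as sets, by perm_eq. *)
Definition relabel n (S : {set chord n}) : seq (nat * nat) :=
  [seq (relabel_endpoint S (source c), relabel_endpoint S (sink c)) | c in S].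

Definition top_cycle (m : nat) : seq (nat * nat) :=
  rcons [seq (2 * i - 1, 2 * i + 2) | i <- index_iota 1 m] (2, 2 * m - 1).

Definition bottom_cycle (m : nat) : seq (nat * nat) :=
  [seq (2 * i, 2 * i + 3) | i <- index_iota 1 (m - 1)]
    ++ [:: (1, 2 * m - 2); (3, 2 * m)].

(* A subdiagram equal to T_m or B_m has m chords, so m <= n loses nothing;
   see has_top_cycleP and has_bottom_cycleP. *)
Definition has_top_cycle n (D : {set chord n}) : bool :=
  [exists S : {set chord n}, (S \subset D) &&
     [exists m : 'I_n.+1, (3 <= m) && perm_eq (relabel S) (top_cycle m)]].

Definition has_bottom_cycle n (D : {set chord n}) : bool :=
  [exists S : {set chord n}, (S \subset D) &&
     [exists m : 'I_n.+1, (3 <= m) && perm_eq (relabel S) (bottom_cycle m)]].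

Lemma size_top_cycle m : 3 <= m -> size (top_cycle m) = m.
Proof.
by move=> m3; rewrite size_rcons size_map size_iota subn1 prednK // ltnW // ltnW.
Qed.

Lemma size_bottom_cycle m : 3 <= m -> size (bottom_cycle m) = m.
Proof.
move=> m3; rewrite size_cat size_map size_iota /= -subnDA.
by rewrite subnK // ltnW.
Qed.

Lemma size_relabel n (S : {set chord n}) : size (relabel S) = #|S|.
Proof. by rewrite size_map -cardE. Qed.

Lemma card_chord_diagram n (D : {set chord n}) : chord_diagram D -> #|D| <= n.
Proof.
case/andP=> /forallP ltD /forallP oneD.
have : \sum_(x : 'I_(2 * n))
   \sum_(c in D) ((source c == x) || (sink c == x) : nat) = 2 * n.
  rewrite (eq_bigr (fun=> 1)) => [|x _]; first by rewrite sum1_card card_ord.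
  rewrite -[RHS](eqP (oneD x)) -sum1_card [LHS]big_mkcond [RHS]big_mkcond /=.
  by apply: eq_bigr => c _; rewrite inE; case: (c \in D); case: (_ || _).
rewrite exchange_big /= => E.
have : 2 * #|D| = 2 * n.
  rewrite -E mulnC -sum_nat_const; apply: eq_bigr => c cD.
  have ne : source c != sink c.
    by rewrite -val_eqE neq_ltn (implyP (ltD c) cD).
  transitivity #|[set source c; sink c]|; first by rewrite cards2 ne.
  rewrite -sum1_card big_mkcond /=; apply: eq_bigr => x _.
  by rewrite !inE ![x == _]eq_sym; case: (_ || _).
by move/eqP; rewrite eqn_pmul2l // => /eqP->.
Qed.

Lemma has_top_cycleP n (D : {set chord n}) : chord_diagram D ->
  reflect (exists S : {set chord n}, S \subset D /\
             exists m, 3 <= m /\ perm_eq (relabel S) (top_cycle m))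
          (has_top_cycle D).
Proof.
move=> dD; apply: (iffP existsP) => [[S /andP[SD /existsP[m /andP[m3 e]]]]|].
  by exists S; split=> //; exists m.
case=> S [SD [m [m3 e]]]; exists S; rewrite SD /=; apply/existsP.
have mn : m < n.+1.
  rewrite ltnS -(size_top_cycle m3) -(perm_size e) size_relabel.
  exact: leq_trans (subset_leq_card SD) (card_chord_diagram dD).
by exists (Ordinal mn); rewrite m3.
Qed.

Lemma has_bottom_cycleP n (D : {set chord n}) : chord_diagram D ->
  reflect (exists S : {set chord n}, S \subset D /\
             exists m, 3 <= m /\ perm_eq (relabel S) (bottom_cycle m))
          (has_bottom_cycle D).
Proof.
move=> dD; apply: (iffP existsP) => [[S /andP[SD /existsP[m /andP[m3 e]]]]|].
  by exists S; split=> //; exists m.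
case=> S [SD [m [m3 e]]]; exists S; rewrite SD /=; apply/existsP.
have mn : m < n.+1.
  rewrite ltnS -(size_bottom_cycle m3) -(perm_size e) size_relabel.
  exact: leq_trans (subset_leq_card SD) (card_chord_diagram dD).
by exists (Ordinal mn); rewrite m3.
Qed.

(* Main.v *)
(* The top-cycle-free 1-terminal diagrams are those in which every chord other
   than the last one has exactly one right neighbor.  If a chord c has two right
   neighbors d and e, following right neighbors from both until the paths meet
   produces a top cycle; conversely every top or bottom cycle contains a chord
   with two right neighbors.  Reading such a diagram from left to right, a sink
   must close the second most recently opened chord (the only open one, for the
   last sink), so the diagram is determined by the positions of its sources;
   deleting the first source and the last sink leaves an arbitrary Dyck path of
   length 2n - 2. *)

Require Import Defs.
From mathcomp Require Import all_boot all_order all_algebra.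
From mathcomp Require Import zify.

Set Implicit Arguments.
Unset Strict Implicit.
Unset Printing Implicit Defensive.

(** * Endpoints of chords and the single-neighbor condition *)

Lemma source_lt_sink n (D : {set chord n}) c :
  chord_diagram D -> c \in D -> source c < sink c.
Proof. by case/andP=> /forallP/(_ c)/implyP. Qed.

Lemma chord_at n (D : {set chord n}) (x : 'I_(2 * n)) : chord_diagram D ->
  exists2 c, c \in D & (source c == x) || (sink c == x).
Proof.
case/andP=> _ /forallP/(_ x)/cards1P[c /setP/(_ c)].
by rewrite !inE eqxx => /andP[]; exists c.
Qed.

Lemma chord_at_inj n (D : {set chord n}) (x : 'I_(2 * n)) c d :
  chord_diagram D -> c \in D -> d \in D ->
  (source c == x) || (sink c == x) -> (source d == x) || (sink d == x) -> c = d.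
Proof.
case/andP=> _ /forallP/(_ x)/cards1P[e /setP E] cD dD cx dx.
by move: (E c) (E d); rewrite !inE cD dD cx dx => /esym/eqP-> /esym/eqP->.
Qed.

Lemma source_inj n (D : {set chord n}) c d : chord_diagram D ->
  c \in D -> d \in D -> source c = source d :> nat -> c = d.
Proof.
move=> dD cD dD' /val_inj e.
by apply: (chord_at_inj (x := source d) dD); rewrite ?e ?eqxx.
Qed.

Lemma sink_inj n (D : {set chord n}) c d : chord_diagram D ->
  c \in D -> d \in D -> sink c = sink d :> nat -> c = d.
Proof.
move=> dD cD dD' /val_inj e.
by apply: (chord_at_inj (x := sink d) dD); rewrite ?e ?eqxx ?orbT.
Qed.

Lemma source_neq_sink n (D : {set chord n}) c d : chord_diagram D ->
  c \in D -> d \in D -> source c <> sink d :> nat.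
Proof.
move=> dD cD dD' /val_inj e.
have E : c = d by apply: (chord_at_inj (x := sink d) dD); rewrite ?e ?eqxx ?orbT.
by move: (source_lt_sink dD cD); rewrite e E ltnn.
Qed.

(** The exempted chord is singled out by its sink, the last point, and not by its source as in
    [last_chord]: a scan from left to right then knows at each sink whether the condition applies.
    In a 1-terminal diagram both descriptions give the same chord. *)
Definition single_neighbor n (D : {set chord n}) : bool :=
  chord_diagram D &&
  [forall c in D, (sink c < (2 * n).-1) ==>
     (#|[set d in D | right_neighbor c d]| == 1)].

Lemma one_terminal_rn n (D : {set chord n}) c d :
  one_terminal D -> c \in D -> d \in D -> source c < source d ->
  exists2 f, f \in D & right_neighbor c f.
Proof.
move=> /forall_inP/(_ c) T cD dD lt; have {T}/implyP := T cD.
have -> : ~~ last_chord D c.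
  by apply/negP => /andP[_ /forall_inP/(_ d dD)]; rewrite leqNgt lt.
move=> /(_ isT); rewrite /terminal cD /= => /forall_inPn[f fD].
by rewrite negbK; exists f.
Qed.

(** The chord of largest source has no right neighbor, which forces it to end at the last point; all
    other chords end earlier and hence have a right neighbor. *)
Lemma single_neighbor_one_terminal n (D : {set chord n}) :
  single_neighbor D -> one_terminal D.
Proof.
case/andP=> dD /forall_inP one; apply/forall_inP => c cD; apply/implyP.
have rn d : d \in D -> sink d < (2 * n).-1 ->
    exists2 f, f \in D & right_neighbor d f.
  move=> dD' lt; have /cards1P[f /setP/(_ f)] := implyP (one d dD') lt.
  by rewrite !inE eqxx => /andP[]; exists f.
rewrite /last_chord cD /= => /forall_inPn[d0 d0D lt0].
have [d dD' dmax] := arg_maxnP (fun d : chord n => source d) d0D.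
apply/negP => /andP[_ /forall_inP T].
case: (ltnP (sink c) (2 * n).-1) => [/(rn c cD)[f fD]|le]; first by rewrite (negPf (T f fD)).
(* Now [c] ends at the last point, so [d] ends earlier and has a right neighbor, whose source
   exceeds the maximum. *)
have dc : source c < source d by have := dmax _ d0D; lia.
have lt : sink d < (2 * n).-1.
  have ne : sink c <> sink d :> nat.
    by move=> /(sink_inj dD cD dD') E; rewrite E ltnn in dc.
  by have := ltn_ord (sink d); have := ltn_ord (sink c); lia.
have [f fD /and3P[+ _ _]] := rn d dD' lt.
by have := dmax _ fD; rewrite /=; lia.
Qed.

Lemma single_neighbor_uniq n (D : {set chord n}) c d e :
  single_neighbor D -> c \in D -> d \in D -> e \in D ->
  right_neighbor c d -> right_neighbor c e -> d = e.
Proof.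
case/andP=> dD /forall_inP one cD dD' eD cd ce.
have lt : sink c < (2 * n).-1.
  by have := ltn_ord (sink d); case/and3P: cd; lia.
have /cards1P[f /setP E] := implyP (one c cD) lt.
by move: (E d) (E e); rewrite !inE dD' eD cd ce => /esym/eqP-> /esym/eqP->.
Qed.

(** * Cycles contain a chord with two right neighbors *)

Lemma relabel_endpoint_lt n (S : {set chord n}) x y :
  relabel_endpoint S x < relabel_endpoint S y -> x < y.
Proof.
apply: contraTT; rewrite -!leqNgt => yx; apply: subset_leq_card.
by apply/subsetP=> z; rewrite !inE => /andP[-> /leq_trans->].
Qed.

Lemma mem_relabel n (S : {set chord n}) s p q :
  perm_eq (relabel S) s -> (p, q) \in s ->
  exists c, [/\ c \in S, relabel_endpoint S (source c) = p
                       & relabel_endpoint S (sink c) = q].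
Proof.
by move=> /perm_mem <- /mapP[c]; rewrite mem_enum => cS [-> ->]; exists c.
Qed.

(** Labels are ranks, so strict inequalities between labels pull back to the endpoints: crossings
    visible in the relabelled list are crossings of the original chords. *)
Lemma relabel_right_neighbor n (S : {set chord n}) s p1 q1 p2 q2 p3 q3 :
  perm_eq (relabel S) s ->
  (p1, q1) \in s -> (p2, q2) \in s -> (p3, q3) \in s ->
  p1 < p2 < q1 -> q1 < q2 -> p1 < p3 < q1 -> q1 < q3 -> p2 <> p3 ->
  exists c d e, [/\ c \in S, d \in S & e \in S] /\
    [/\ right_neighbor c d, right_neighbor c e & d <> e].
Proof.
move=> es /(mem_relabel es)[c [cS <- <-]] /(mem_relabel es)[d [dS <- <-]].
case/(mem_relabel es)=> e [eS <- <-] /andP[h1 h2] h3 /andP[h4 h5] h6 ne.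
exists c, d, e; split=> //; split; last by move=> de; rewrite de in ne.
  by apply/and3P; split; apply: (@relabel_endpoint_lt _ S).
by apply/and3P; split; apply: (@relabel_endpoint_lt _ S).
Qed.

(** In T_m the chord (1, 4) has the right neighbors (2, 2m-1) and (3, 6). *)
Lemma single_neighbor_no_top n (D : {set chord n}) :
  single_neighbor D -> ~~ has_top_cycle D.
Proof.
move=> sD; apply/negP => /existsP[S /andP[/subsetP SD /existsP[m /andP[m3 e]]]].
have T i : 1 <= i < m -> (2 * i - 1, 2 * i + 2) \in top_cycle m.
  move=> im; rewrite mem_rcons inE; apply/orP; right.
  by apply/mapP; exists i; rewrite ?mem_index_iota.
have T0 : (2, 2 * m - 1) \in top_cycle m by rewrite mem_rcons inE eqxx.
have [||||| c [d [f [[cS dS fS] [cd cf]]]]] :=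
  relabel_right_neighbor e (T 1 ltac:(lia)) T0 (T 2 ltac:(lia)); try lia.
by apply; apply: (single_neighbor_uniq sD (SD c cS)) => //; apply: SD.
Qed.

(** In B_m the chord (1, 2m-2) has the right neighbors (2m-4, 2m-1) and (3, 2m). *)
Lemma single_neighbor_no_bottom n (D : {set chord n}) :
  single_neighbor D -> ~~ has_bottom_cycle D.
Proof.
move=> sD; apply/negP => /existsP[S /andP[/subsetP SD /existsP[m /andP[m3 e]]]].
have B i : 1 <= i < m - 1 -> (2 * i, 2 * i + 3) \in bottom_cycle m.
  move=> im; rewrite mem_cat; apply/orP; left.
  by apply/mapP; exists i; rewrite ?mem_index_iota.
have B1 : (1, 2 * m - 2) \in bottom_cycle m by rewrite mem_cat !inE eqxx orbT.
have B3 : (3, 2 * m) \in bottom_cycle m by rewrite mem_cat !inE eqxx !orbT.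
have [||||| c [d [f [[cS dS fS] [cd cf]]]]] :=
  relabel_right_neighbor e B1 (B (m - 2) ltac:(lia)) B3; try lia.
by apply; apply: (single_neighbor_uniq sD (SD c cS)) => //; apply: SD.
Qed.

(** * Recognizing a top cycle *)

Lemma card_le_strict_mono n N (h : nat -> 'I_n) j : j < N ->
  (forall i k, i < k < N -> h i < h k) ->
  #|[set y in [set h i | i : 'I_N] | y <= h j]| = j.+1.
Proof.
move=> jN hm.
have hi i k : i < N -> k < N -> (h i <= h k) = (i <= k).
  move=> iN kN; case: (ltngtP i k) => [lt|lt|->]; last by rewrite leqnn.
    by rewrite ltnW // hm // lt.
  by apply/negbTE; rewrite -ltnNge hm // lt.
transitivity (size [seq h i | i <- iota 0 j.+1]); last by rewrite size_map size_iota.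
rewrite -(card_uniqP _); last first.
  rewrite map_inj_in_uniq ?iota_uniq // => i k; rewrite !mem_iota !add0n !ltnS.
  move=> ij kj E; have [iN kN] := (leq_ltn_trans ij jN, leq_ltn_trans kj jN).
  have := hi i k iN kN; have := hi k i kN iN; rewrite E leqnn => /esym ki /esym ik.
  by apply/eqP; rewrite eqn_leq ik ki.
apply: eq_card => y; rewrite inE; apply/andP/mapP => [[/imsetP[i _ ->]]|[i]].
  by rewrite hi // => ij; exists (val i); rewrite ?mem_iota.
rewrite mem_iota add0n => /andP[_ ij] ->; have iN : i < N by lia.
by split; [apply/imsetP; exists (Ordinal iN)|rewrite hi].
Qed.

(** The cycle found is T_m with m = k+2: the path [L] supplies the chords (2i-1, 2i+2) and [d] is
    the long chord (2, 2m-1). The hypotheses fix the relative order of all endpoints, hence all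
    labels. *)
Lemma has_top_cycle_path n (D : {set chord n}) (d : chord n) (L : seq (chord n)) :
  let c i := nth d L i in let k := (size L).-1 in
  chord_diagram D -> d \in D -> {subset L <= D} -> 1 < size L ->
  (forall i, i < k -> right_neighbor (c i) (c i.+1)) ->
  (forall i, i.+1 < k -> sink (c i) < source (c i.+2)) ->
  source (c 0) < source d < source (c 1) ->
  sink (c k.-1) < sink d < sink (c k) ->
  has_top_cycle D.
Proof.
move=> c k dD dd LD szL rn far /andP[sd0 sd1] /andP[td0 td1].
have Ek : size L = k.+1 by rewrite prednK // ltnW.
have k0 : 0 < k by rewrite -ltnS -Ek.
clearbody k.
have inL x : reflect (exists2 i, i <= k & x = c i) (x \in L).
  by apply: (iffP (nthP d)) => [[i]|[i ik ->]]; rewrite ?Ek; exists i; rewrite ?Ek.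
have cE i : nth d L i = c i by [].
clearbody c.
(* The increasing order of the endpoints, listed by h, is
   s(c0) s(d) s(c1) t(c0) s(c2) t(c1) ... s(ck) t(c(k-1)) t(d) t(ck). *)
pose A i := if i == k.+1 then sink d else source (c i).
pose B i := if i == 0 then source d else sink (c i.-1).
pose h i := if odd i then B i./2 else A i./2.
have Ai i : i <= k -> A i = source (c i) by rewrite /A; case: eqP => //; lia.
have Ak : A k.+1 = sink d by rewrite /A eqxx.
have BS i : B i.+1 = sink (c i) by [].
(* For the endpoints of the path, [A i < B i] says that consecutive chords cross, and [B i < A i.+1]
   that a chord ends before the next but one starts. *)
have AB i : i <= k.+1 -> A i < B i.
  rewrite leq_eqVlt => /predU1P[->|]; first by rewrite Ak BS.
  case: i => [_|i ik]; rewrite Ai // BS.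
  by case/and3P: (rn i ik).
have BA i : i <= k -> B i < A i.+1.
  rewrite leq_eqVlt => /predU1P[->|]; first by rewrite Ak -(prednK k0) BS.
  case: i => [_|i ik]; first by rewrite Ai.
  by rewrite BS Ai //; apply: far.
have hS i : i < (2 * k).+3 -> h i < h i.+1.
  move=> iN; rewrite /h /=; case: (boolP (odd i)) => oi /=.
    by rewrite uphalf_half oi; apply: BA; lia.
  by rewrite uphalf_half (negPf oi); apply: AB; lia.
have hm i j : i < j < 2 * k.+2 -> h i < h j.
  move=> /andP[]; elim: j => // j IH; rewrite ltnS leq_eqVlt => /predU1P[-> jN|ij jN].
    by apply: hS; lia.
  by apply: (ltn_trans (IH ij _)); [lia|apply: hS; lia].
pose S := [set x in rcons L d].
have memS x : (x \in S) = (x == d) || (x \in L) by rewrite inE mem_rcons inE.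
have ES : endpoints S = [set h i | i : 'I_(2 * k.+2)].
  have hE i : i < 2 * k.+2 -> h i \in [set h i | i : 'I_(2 * k.+2)].
    by move=> iN; apply/imsetP; exists (Ordinal iN).
  apply/setP=> x; rewrite /endpoints in_setU; apply/orP/idP.
    case=> /imsetP[y]; rewrite memS => /predU1P[->|/inL[i ik ->]] ->.
    - by have := hE 1; rewrite /h /B /=; apply; lia.
    - by have := hE (2 * i); rewrite /h /A mul2n odd_double doubleK ifN; [apply|]; lia.
    - have := hE (2 * k.+1).
      by rewrite /h /A mul2n odd_double doubleK eqxx; apply; lia.
    - have := hE (2 * i.+1).+1.
      by rewrite /h /B mul2n /= odd_double uphalf_double; apply; lia.
  case/imsetP=> [[i iN] _ ->] /=; rewrite /h; case: ifP => _.
    rewrite /B; case: eqP => ne; [left|right].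
      by apply/imsetP; exists d; rewrite // memS eqxx.
    by apply/imsetP; exists (c i./2.-1); rewrite // memS; apply/orP; right;
       apply/inL; eexists; last reflexivity; lia.
  rewrite /A; case: eqP => ne; [right|left].
    by apply/imsetP; exists d; rewrite // memS eqxx.
  by apply/imsetP; exists (c i./2); rewrite // memS; apply/orP; right;
       apply/inL; eexists; last reflexivity; lia.
have rk i : i < 2 * k.+2 -> relabel_endpoint S (h i) = i.+1.
  by move=> iN; rewrite /relabel_endpoint ES card_le_strict_mono.
apply/(has_top_cycleP dD); exists S; split.
  by apply/subsetP => x; rewrite memS => /predU1P[->|/LD].
exists k.+2; split; first lia.
pose F x := (relabel_endpoint S (source x), relabel_endpoint S (sink x)).
have hA i : h (2 * i) = A i by rewrite /h (mul2n i) odd_double doubleK.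
have hB i : h (2 * i).+1 = B i by rewrite /h (mul2n i) /= odd_double uphalf_double.
have Fd : F d = (2, 2 * k.+2 - 1).
  by rewrite /F -[source d](hB 0) -Ak -hA !rk; first congr pair; lia.
have Fc i : i <= k -> F (c i) = (2 * i.+1 - 1, 2 * i.+1 + 2).
  move=> ik; rewrite /F -BS -Ai // -hA -hB !rk; first congr pair; lia.
(* The chords are pairwise distinct because their labels are. *)
have unL : uniq L.
  apply/(uniqP d) => i j; rewrite !inE Ek !cE !ltnS => ik jk E.
  by have := Fc i ik; rewrite E Fc // => -[]; lia.
have dL : d \notin L.
  by apply/negP => /inL[i ik E]; have := Fc i ik; rewrite -E Fd => -[]; lia.
have -> : top_cycle k.+2 = map F (rcons L d).
  rewrite map_rcons Fd /top_cycle; congr rcons.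
  apply: (@eq_from_nth _ (0, 0)) => [|i].
    by rewrite !size_map size_iota Ek; lia.
  rewrite size_map size_iota subSS subn0 => ik.
  rewrite (nth_map 0) ?size_iota // (nth_map d) ?Ek // cE Fc //.
  by rewrite nth_iota ?subSS ?subn0.
apply: (perm_map F); apply: uniq_perm; first exact: enum_uniq.
  by rewrite rcons_uniq dL.
by move=> x; rewrite mem_enum inE.
Qed.

(** * Two right neighbors force a top cycle *)

(** Sources and sinks both increase along right neighbors, so [x] and [z] cross as soon as [z]
    starts before [x] ends. This allows [y] to be skipped in a path. *)
Lemma right_neighbor_trans n (D : {set chord n}) x y z :
  chord_diagram D -> x \in D -> z \in D ->
  right_neighbor x y -> right_neighbor y z -> ~~ (sink x < source z) ->
  right_neighbor x z.
Proof.
move=> dD xD zD /and3P[xy1 _ xy2] /and3P[yz1 _ yz2].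
have := source_neq_sink dD zD xD.
case: ltngtP => // [zx _ _|-> []//].
by rewrite /right_neighbor zx (ltn_trans xy1 yz1); apply: ltn_trans yz2.
Qed.

(* Say e is nested in d (otherwise c, e, d form T_3). Some chord q, reached from c
   by a path nested in d, and d have a common right neighbor f; once the path has
   no shortcut from a chord to the next but one, it forms T_m together with d
   and f. *)
Lemma two_right_neighbors_top n (D : {set chord n}) c d e :
  chord_diagram D -> one_terminal D -> c \in D -> d \in D -> e \in D ->
  right_neighbor c d -> right_neighbor c e -> d <> e -> has_top_cycle D.
Proof.
move=> dD oD cD dd eD cd ce de.
wlog lt : d e dd eD cd ce de / sink e < sink d.
  move=> W; case: (ltngtP (sink e) (sink d)) => [|lt|/(sink_inj dD eD dd) E].
  - exact: W.
  - by apply: (W e d) => // E; apply: de.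
  - by case: de.
pose inside (x : chord n) := (source d < source x) && (sink x < sink d).
pose r (x y : chord n) := [&& y \in D, right_neighbor x y & inside y].
have rP p x : path r c p -> x \in c :: p -> x \in D /\ (x = c \/ inside x).
  elim: p c cD {cd ce} => [|y p IH] z zD /=.
    by rewrite inE => _ /eqP->; split=> //; left.
  case/andP=> /and3P[yD _ iy] yp; rewrite inE => /predU1P[->|].
    by split=> //; left.
  by case/(IH y yD yp) => xD [->|ix]; split=> //; right.
(* Induction on the length of the path: a shortcut from [l i] to [l i.+2] removes [l i.+1]; without
   shortcuts [has_top_cycle_path] applies. *)
have top p f : path r c p -> f \in D -> right_neighbor (last c p) f ->
    right_neighbor d f -> has_top_cycle D.
  have [m] := ubnP (size p); elim: m p f => // m IH p f le cp fD lf df.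
  pose L := c :: rcons p f; pose l i := nth d L i.
  have szL : size L = (size p).+2 by rewrite /= size_rcons.
  have lE i : i <= size p -> l i = nth d (c :: p) i.
    by move=> ip; rewrite /l /L -rcons_cons nth_rcons /= ltnS ip.
  have lf' : l (size p).+1 = f.
    by rewrite /l /L -rcons_cons nth_rcons /= ltnn eqxx.
  have ll : l (size p) = last c p by rewrite lE // (last_nth d).
  have lr i : i < size p -> r (l i) (l i.+1).
    by move=> ip; rewrite (lE i (ltnW ip)) (lE i.+1 ip); move/(pathP d): (cp); apply.
  have lP i : i <= size p -> l i \in D /\ (l i = c \/ inside (l i)).
    by move=> ip; rewrite lE //; apply: (rP p) => //; apply: mem_nth.
  have lrn i : i <= size p -> right_neighbor (l i) (l i.+1).
    rewrite leq_eqVlt => /predU1P[->|ip]; first by rewrite ll lf'.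
    by case/and3P: (lr i ip).
  have tk i : i <= size p -> last c (take i p) = l i.
    by case: i => [|i] ip; rewrite ?take0 // (last_nth d) size_takel // lE //= nth_take.
  have cut i : path r c (take i p) && path r (last c (take i p)) (drop i p).
    by rewrite -cat_path cat_take_drop.
  case: (boolP [exists i : 'I_(size p), ~~ (sink (l i) < source (l i.+2))]).
    case/existsP=> [[i ip]] /= nfar.
    have iD : l i \in D by case: (lP i (ltnW ip)).
    (* The shortcut lands either on a chord of [p] or, when [l i.+1] is the last chord of [p], on
       [f]. *)
    case: (ltngtP i.+1 (size p)) ip => // [ip _|ip _].
      have [jD ij] := lP i.+2 ip.
      have rn2 : right_neighbor (l i) (l i.+2).
        exact: right_neighbor_trans dD iD jD (lrn i (ltnW (ltnW ip))) (lrn i.+1 (ltnW ip)) nfar.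
      have Ep : last c p = last (l i.+2) (drop i.+2 p).
        by rewrite -tk // -last_cat cat_take_drop.
      have Ed : drop i.+1 p = l i.+2 :: drop i.+2 p by rewrite (drop_nth d) // lE.
      apply: (IH (take i p ++ drop i.+1 p) f) => //.
      - have ip' : i <= size p by exact: ltnW (ltnW ip).
        by rewrite size_cat size_takel // size_drop; move: ip le; clear; lia.
      - rewrite cat_path Ed; case/andP: (cut i) => -> _ /=.
        rewrite tk; last exact: ltnW (ltnW ip).
        rewrite /r jD rn2 /=.
        have /andP[_] := cut i.+2; rewrite tk // => ->; rewrite andbT.
        by case/and3P: (lr i.+1 ip).
      - by rewrite last_cat Ed /= -Ep.
    have ip' : i < size p by rewrite -ip.
    have fE : l i.+2 = f by rewrite ip.
    apply: (IH (take i p) f) => //.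
    - by move: le; rewrite (size_takel (ltnW ip')) -ip.
    - by case/andP: (cut i).
    rewrite tk; last exact: ltnW.
    have := right_neighbor_trans dD iD _ (lrn i (ltnW ip')) (lrn i.+1 ip') nfar.
    by rewrite fE; apply.
  rewrite negb_exists => /forallP far.
  apply: (has_top_cycle_path (d := d) (L := L)) => //; rewrite ?szL // /=.
  - move=> x; rewrite inE mem_rcons inE => /predU1P[->//|/predU1P[->//|xp]].
    by case: (rP p x cp); rewrite // inE xp orbT.
  - by move=> i ip; have := far (Ordinal (ip : i < size p)); rewrite negbK.
  - have -> : nth d (rcons p f) 0 = l 1 by [].
    have -> /= : source c < source d by case/and3P: cd.
    case: (posnP (size p)) lf' => [->|p0] lf'; first by rewrite lf'; case/and3P: df.
    by case/and3P: (lr 0 p0) => _ _ /andP[].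
  rewrite -/(l (size p)) (_ : nth d _ _ = f) //; case/and3P: (df) => _ _ ->; rewrite andbT.
  by case: (lP _ (leqnn _)) => _ [->|/andP[]//]; case/and3P: cd.
have triangle x : x \in D -> right_neighbor c x -> right_neighbor x d -> has_top_cycle D.
  move=> xD /and3P[cx xc tcx] /and3P[xd dx txd].
  apply: (has_top_cycle_path (d := x) (L := [:: c; d])) => //=.
  - by move=> y; rewrite !inE => /orP[]/eqP->.
  - by case.
  - by rewrite cx xd.
  - by rewrite tcx txd.
case: (ltngtP (source e) (source d)) => [lte|lte|/(source_inj dD eD dd) E]; last by case: de.
  by apply: (triangle e) => //; move/and3P: cd ce => [? ? ?] /and3P[? ? ?]; apply/and3P; split; lia.
have [f fD df] := one_terminal_rn oD dd eD lte.
have Qe : connect r c e by apply: connect1; rewrite /r eD ce /inside lte.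
(* Among the chords reachable from [c] that start before [f], the one with the largest source is
   taken as [q]. *)
pose before q := connect r c q && (source q < source f).
have cf : before c.
  by rewrite /before connect0; case/and3P: cd df => cd _ _ /and3P[df _ _]; apply: ltn_trans df.
case: (@arg_maxnP _ c before (fun q : chord n => source q) cf) => q /andP[cq qf] qmax.
have [qD qc] : q \in D /\ (q = c \/ inside q).
  by case/connectP: (cq) => p cp ->; apply: (rP p) => //; apply: mem_last.
suff [g [gD qg dg]] : exists g, [/\ g \in D, right_neighbor q g & right_neighbor d g].
  by case/connectP: cq qg => p cp -> qg; apply: (top p g).
have qdf : sink q < sink d by case: qc => [->|/andP[]//]; case/and3P: cd.
(* If [f] starts before [q] ends, [f] itself is the common right neighbor. Otherwise [q] is not [c],
   since [e] would be a later candidate, and a right neighbor [g] of [q] starts before [f];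
   maximality of [q] forbids [g] to be nested in [d], so [g] crosses [d]. *)
case: (ltngtP (source f) (sink q)) => [lf|gf|/(source_neq_sink dD fD qD)//].
  exists f; split=> //; rewrite /right_neighbor qf lf (ltn_trans qdf) //.
  by case/and3P: df.
case: qc => [E|/andP[dq _]].
  case/and3P: ce => ce1 ce2 _; have : source e <= source q.
    by apply: qmax; rewrite /before Qe; apply: ltn_trans gf; rewrite E.
  by rewrite E leqNgt ce1.
have [g gD qg] := one_terminal_rn oD qD fD qf; have /and3P[g1 g2 g3] := qg.
case: (ltngtP (sink g) (sink d)) => [gd|dg|/(sink_inj dD gD dd) E].
- have : source g <= source q.
    apply: qmax; rewrite /before (connect_trans cq (connect1 _)) ?(ltn_trans g2) //.
    by rewrite /r gD qg /inside gd (ltn_trans dq).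
  by rewrite leqNgt g1.
- by exists g; split=> //; rewrite /right_neighbor dg (ltn_trans dq g1) (ltn_trans g2 qdf).
- by move: (ltn_trans dq g1); rewrite E ltnn.
Qed.

Lemma single_neighborP n (D : {set chord n}) :
  single_neighbor D = [&& chord_diagram D, one_terminal D & ~~ has_top_cycle D].
Proof.
apply/idP/and3P => [sD|[dD oD nT]].
  by split; [case/andP: sD|apply: single_neighbor_one_terminal|
             apply: single_neighbor_no_top].
rewrite /single_neighbor dD /=; apply/forall_inP => c cD; apply/implyP => lt.
have lt' := ltn_ord (sink c).
have last_lt : (2 * n).-1 < 2 * n by lia.
have [f fD cf] : exists2 f, f \in D & right_neighbor c f.
  (* The chord [x] ending at the last point has no right neighbor, so 1-terminality gives it the
     largest source; [c] is therefore not the last chord. *)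
  have [x xD /orP[]/eqP/(congr1 val)/= E] := chord_at (Ordinal last_lt) dD.
    by have := source_lt_sink dD xD; have := ltn_ord (sink x); lia.
  case: (ltngtP (source c) (source x)) => [|xc|/(source_inj dD cD xD) cx].
  - exact: one_terminal_rn.
  - have [g _ /and3P[_ _]] := one_terminal_rn oD xD cD xc.
    by have := ltn_ord (sink g); lia.
  - by rewrite cx in lt; lia.
apply/cards1P; exists f; apply/setP => g; rewrite !inE.
apply/andP/eqP => [[gD cg]|-> //]; apply/eqP; apply: contraNT nT => /eqP ne.
exact: (two_right_neighbors_top dD oD cD gD fD cg cf ne).
Qed.

(** * Scanning a diagram from left to right *)

Definition closed_chords n (D : {set chord n}) (i : nat) : {set chord n} :=
  [set c in D | sink c < i].

Definition open_sources n (D : {set chord n}) (i : nat) : {set 'I_(2 * n)} :=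
  [set source c | c in [set c in D | source c < i <= sink c]].

(* P is the set of chords already closed to the left of i, and O the set of
   sources whose chord is still open there. *)
Definition completions n i (P : {set chord n}) (O : {set 'I_(2 * n)}) :
    {set {set chord n}} :=
  [set D | [&& single_neighbor D, closed_chords D i == P & open_sources D i == O]].

(** The last clause counts final right neighbors: an open source between the endpoints of a closed
    chord can only be closed beyond its sink, so it yields a right neighbor in every completion. *)
Definition partial_diagram n i (P : {set chord n}) (O : {set 'I_(2 * n)}) : Prop :=
  [/\ {in P, forall c, source c < sink c < i},
      {in O, forall y : 'I_(2 * n), y < i},
      forall x : 'I_(2 * n), x < i ->
        #|[set c in P | (source c == x) || (sink c == x)]| + (x \in O) = 1
    & {in P, forall c, sink c < (2 * n).-1 ->
        #|[set d in P | right_neighbor c d]|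
        + #|[set y in O | source c < y < sink c]| = 1}].

Lemma card_sub_setU1 (T : finType) (A : {set T}) (p : pred T) a :
  a \notin A -> #|[set x in a |: A | p x]| = p a + #|[set x in A | p x]|.
Proof.
move=> aA; rewrite (cardsD1 a) !inE eqxx /=; congr (_ + _); apply: eq_card => x.
by rewrite !inE; case: eqP => [->|_] //=; rewrite (negPf aA).
Qed.

Lemma card_sub_setD1 (T : finType) (A : {set T}) (p : pred T) a :
  a \in A -> #|[set x in A | p x]| = p a + #|[set x in A :\ a | p x]|.
Proof. by move=> aA; rewrite -{1}(setD1K aA) card_sub_setU1 // !inE eqxx. Qed.

Lemma no_chord_at n (P : {set chord n}) (x : 'I_(2 * n)) :
  {in P, forall c, source c < sink c < x} ->
  [set c in P | (source c == x) || (sink c == x)] = set0.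
Proof.
move=> Plt; apply/setP => c; rewrite !inE; apply/negP => /andP[/Plt/andP[lt1 lt2]].
case/orP=> /eqP/(congr1 val)/= E; move: lt2; rewrite -E ?ltnn //.
by rewrite ltnNge ltnW.
Qed.

Lemma partial_diagram_source n (x : 'I_(2 * n)) P O :
  partial_diagram x P O -> partial_diagram x.+1 P (x |: O).
Proof.
case=> Plt Olt cover one; split.
- by move=> c /Plt/andP[-> /ltnW].
- by move=> y; rewrite in_setU1 => /predU1P[->//|/Olt/ltnW].
- move=> z; rewrite ltnS leq_eqVlt => /predU1P[/val_inj->|zx].
    by rewrite setU11 no_chord_at // cards0.
  rewrite in_setU1 (_ : (z == x) = false) ?cover //.
  by apply/eqP => E; rewrite E ltnn in zx.
- move=> c cP lt; rewrite card_sub_setU1; last by apply/negP => /Olt; rewrite ltnn.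
  rewrite (_ : _ && _ = false) ?one //; apply/negP => /andP[_].
  by case/andP: (Plt c cP) => _ cx; rewrite ltnNge ltnW.
Qed.

(** The open sources beyond [a] are the future right neighbors of the new chord. For an older chord
    the total is unchanged: if [a] was counted as an open source, [(a, x)] is now counted as a
    closed right neighbor. *)
Lemma partial_diagram_sink n (x a : 'I_(2 * n)) P O :
  partial_diagram x P O -> a \in O ->
  #|[set y in O | a < y]| = (x < (2 * n).-1) ->
  partial_diagram x.+1 ((a, x) |: P) (O :\ a).
Proof.
case=> Plt Olt cover one aO rank.
have ax := Olt a aO.
have nP : (a, x) \notin P by apply/negP => /Plt /andP[_]; rewrite ltnn.
have xO : x \notin O by apply/negP => /Olt; rewrite ltnn.
split.
- move=> c; rewrite in_setU1 => /predU1P[->|/Plt/andP[-> /ltnW//]].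
  by rewrite /source /sink /= ax ltnSn.
- by move=> y; rewrite in_setD1 => /andP[_ /Olt/ltnW].
- move=> z zx; rewrite card_sub_setU1 // in_setD1.
  move: zx; rewrite ltnS leq_eqVlt => /predU1P[/val_inj->|zx].
    by rewrite no_chord_at // cards0 /sink /= eqxx orbT (negPf xO) andbF.
  have := cover z zx; rewrite {2}/source {2}/sink /= (_ : (x == z) = false); last first.
    by apply/eqP => E; rewrite E ltnn in zx.
  rewrite orbF eq_sym; case: eqP => [->|_] //=.
  by rewrite aO !addn1 => -[->].
- move=> c; rewrite in_setU1 => /predU1P[->|cP] lt; rewrite card_sub_setU1 //.
    have -> : right_neighbor (a, x) (a, x) = false.
      by rewrite /right_neighbor /= ltnn.
    rewrite (_ : [set _ in P | _] = set0) ?cards0 ?add0n; last first.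
      apply/setP => d; rewrite !inE; apply/negP => /andP[/Plt/andP[_ dx] /and3P[_ _]].
      by rewrite ltnNge ltnW.
    rewrite {1}/sink /= in lt; rewrite lt in rank; rewrite -[RHS]rank.
    apply: eq_card => y; rewrite !inE.
    rewrite /source /sink /=; case yO : (y \in O); rewrite ?andbF //=.
    by rewrite (Olt y yO) andbT andbT; case: eqP => [->|]; rewrite ?ltnn.
  have := one c cP lt; rewrite (card_sub_setD1 _ aO).
  rewrite (_ : right_neighbor c (a, x) = (source c < a < sink c)).
    by rewrite addnCA addnA.
  by rewrite /right_neighbor; have /andP[_ ->] := Plt c cP; rewrite andbT.
Qed.

(** Ranks are counted from the right, so removing the largest element lowers every other rank by
    one. Together with [rank_inj] this selects the unique open source that a sink may close. *)
Lemma exists_rank n (O : {set 'I_n}) e : e < #|O| ->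
  exists2 a, a \in O & #|[set y in O | a < y]| = e.
Proof.
elim: e O => [|e IH] O eO; have [b0 b0O] : exists b, b \in O by apply/card_gt0P; lia.
  case: (arg_maxnP (fun y : 'I_n => y) b0O) => b bO bmax; exists b => //.
  apply/eqP; rewrite cards_eq0; apply/eqP/setP => y; rewrite !inE.
  by apply/negP => /andP[/bmax]; rewrite /= leqNgt => /negPf->.
case: (arg_maxnP (fun y : 'I_n => y) b0O) => b + bmax; rewrite -/(b \in O) => bO.
have [|a] := IH (O :\ b); first by move: eO; rewrite (cardsD1 b) bO.
rewrite in_setD1 => /andP[ab aO] E; exists a => //.
have ab' : a < b by have := bmax a aO; rewrite /= leq_eqVlt val_eqE (negPf ab).
by rewrite (card_sub_setD1 _ bO) E ab'.
Qed.

Lemma rank_inj n (O : {set 'I_n}) a b : a \in O -> b \in O ->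
  #|[set y in O | a < y]| = #|[set y in O | b < y]| -> a = b.
Proof.
wlog lt : a b / a < b => [W|] aO bO E.
  case: (ltngtP a b) => [lt|lt|/val_inj //]; first exact: W.
  by apply/esym/W.
suff : #|[set y in O | b < y]| < #|[set y in O | a < y]| by rewrite E ltnn.
apply: proper_card; apply/properP; split.
  by apply/subsetP => y; rewrite !inE => /andP[->]; apply: ltn_trans.
by exists b; rewrite !inE bO ?ltnn.
Qed.

Lemma mem_open_sources n (D : {set chord n}) c i : chord_diagram D -> c \in D ->
  (source c \in open_sources D i) = (source c < i <= sink c).
Proof.
move=> dD cD; apply/imsetP/idP => [[d]|ci].
  by rewrite inE => /andP[d_D di] /(congr1 val)/(source_inj dD cD d_D)->.
by exists c; rewrite // inE cD.
Qed.

Lemma open_sources_source n (D : {set chord n}) c : chord_diagram D -> c \in D ->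
  closed_chords D (source c).+1 = closed_chords D (source c) /\
  open_sources D (source c).+1 = source c |: open_sources D (source c).
Proof.
move=> dD cD; split.
  apply/setP => d; rewrite !inE ltnS leq_eqVlt.
  case dD' : (d \in D) => //=; case: eqP => // E.
  by case: (source_neq_sink dD cD dD').
apply/setP => y; rewrite in_setU1.
case: (chord_at y dD) => d dD' /orP[]/eqP<-.
  rewrite !mem_open_sources // -val_eqE ltnS leq_eqVlt.
  case: eqP => [/(source_inj dD dD' cD)->|ne] /=.
    exact: source_lt_sink dD cD.
  have ne' := source_neq_sink dD cD dD'.
  by case: ltnP => //= _; rewrite [RHS]leq_eqVlt; case: eqP.
have F i : sink d \in open_sources D i = false.
  apply/negbTE/negP => /imsetP[f]; rewrite inE => /andP[fD _].
  by move=> /(congr1 val)/= /esym; apply: source_neq_sink dD fD dD'.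
by rewrite !F orbF; apply/esym/eqP => /(congr1 val)/= /esym; apply: source_neq_sink dD cD dD'.
Qed.

(** The last clause lets the scan see the single-neighbor condition: the right neighbors of [c] are
    the chords open at [sink c] that started after [c]. *)
Lemma open_sources_sink n (D : {set chord n}) c : chord_diagram D -> c \in D ->
  [/\ closed_chords D (sink c).+1 = c |: closed_chords D (sink c),
      open_sources D (sink c).+1 = open_sources D (sink c) :\ source c,
      source c \in open_sources D (sink c)
    & #|[set d in D | right_neighbor c d]|
      = #|[set y in open_sources D (sink c) | source c < y]|].
Proof.
move=> dD cD; have cc := source_lt_sink dD cD; split.
- apply/setP => d; rewrite !inE ltnS leq_eqVlt.
  case dD' : (d \in D) => /=; last by rewrite orbF; case: eqP => // E; rewrite E cD in dD'.
  case: (eqVneq d c) => [->|ne]; first by rewrite eqxx.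
  by case: eqP => // /(sink_inj dD dD' cD) E; rewrite E eqxx in ne.
- apply/setP => y; rewrite in_setD1.
  case: (chord_at y dD) => d dD' /orP[]/eqP<-.
    rewrite !mem_open_sources // -val_eqE.
    case: eqP => [/(source_inj dD dD' cD)->|ne] /=; first by rewrite ltnn andbF.
    have ne' := source_neq_sink dD dD' cD.
    rewrite ltnS leq_eqVlt; case: eqP => //= _; case: ltnP => //= _.
    rewrite [RHS]leq_eqVlt; case: eqP => // /esym /(sink_inj dD dD' cD) E.
    by rewrite E in ne.
  have F i : sink d \in open_sources D i = false.
    apply/negbTE/negP => /imsetP[f]; rewrite inE => /andP[fD _].
    by move=> /(congr1 val)/= /esym; apply: source_neq_sink dD fD dD'.
  by rewrite !F andbF.
- by rewrite mem_open_sources // cc leqnn.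
rewrite -(card_in_imset (f := @source n) (D := [set d in D | right_neighbor c d])).
  apply: eq_card => y; rewrite inE; apply/imsetP/andP.
    case=> d; rewrite inE => /andP[dD' /and3P[d1 d2 d3]] ->.
    by rewrite mem_open_sources // d2 (ltnW d3).
  case=> /imsetP[d]; rewrite inE => /andP[dD' /andP[d1 d2]] -> lt.
  exists d; rewrite // inE dD' /right_neighbor lt d1 /= ltn_neqAle d2 andbT.
  by apply/eqP => /(sink_inj dD cD dD') E; rewrite E ltnn in lt.
move=> d f; rewrite !inE => /andP[d1 _] /andP[f1 _] /(congr1 val).
exact: source_inj dD d1 f1.
Qed.

(* Counts the paths of m steps +1 or -1 from height k to 0 that stay positive
   except possibly at both ends. *)
Fixpoint positive_paths k m : nat :=
  if m is m'.+1 then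
    positive_paths k.+1 m' + (if (0 < m') < k then positive_paths k.-1 m' else 0)
  else k == 0.

(** The path height is the number of open sources. A source at point [i] is always possible; a sink
    must close the open source of rank [0 < m'], with [m'] points left after it, and this source
    exists exactly when [(0 < m') < #|O|]. *)
Lemma card_completions n i m (P : {set chord n}) O :
  i + m = 2 * n -> partial_diagram i P O ->
  #|completions i P O| = positive_paths #|O| m.
Proof.
elim: m i P O => [|m IH] i P O /= im pd.
  rewrite addn0 in im; subst i; have [Plt Olt cover one] := pd.
  (* At the right end all chords are closed, so [P] is the only possible completion, and it is one
     exactly when [O] is empty. *)
  have noO (D : {set chord n}) : open_sources D (2 * n) = set0.
    apply/setP => y; rewrite [RHS]inE; apply/negbTE/negP => /imsetP[c].
    by rewrite inE => /and3P[_ _]; rewrite leqNgt ltn_ord.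
  have allP (D : {set chord n}) : closed_chords D (2 * n) = D.
    by apply/setP => c; rewrite inE ltn_ord andbT.
  case: (set_0Vmem O) => [O0|[y yO]]; last first.
    have /card_gt0P : exists y, y \in O by exists y.
    rewrite lt0n => /negPf->; apply/eqP; rewrite cards_eq0; apply/eqP/setP => D.
    by rewrite !inE noO; apply/negbTE/and3P => -[_ _ /eqP E]; rewrite -E inE in yO.
  rewrite O0 cards0 eqxx; apply/eqP/cards1P; exists P; apply/setP => D.
  rewrite !inE noO eqxx andbT allP; case: eqP => [->|]; rewrite ?andbF // andbT.
  apply/andP; split.
    apply/andP; split; first by apply/forall_inP => c /Plt/andP[].
    apply/forallP => x; have := cover x (ltn_ord x).
    by rewrite O0 inE addn0 => ->.
  apply/forall_inP => c cP; apply/implyP => lt; have := one c cP lt.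
  rewrite O0 (_ : [set _ in set0 | _] = set0) ?cards0 ?addn0 => [-> //|].
  by apply/setP => y; rewrite !inE.
have [Plt Olt cover one] := pd.
have xn : i < 2 * n by rewrite -im addnS ltnS leq_addr.
pose x := Ordinal xn.
(* Read as a number, [0 < m] is the number of right neighbors required of a chord ending at [i]:
   none at the last point, one before it. *)
have em : (i < (2 * n).-1) = (0 < m) by rewrite -im addnS /= -{1}[i]addn0 ltn_add2l.
have xO : x \notin O by apply/negP => /Olt; rewrite ltnn.
have im' : i.+1 + m = 2 * n by rewrite addSnnS.
(* The completions are split by whether [x] is a source or a sink. *)
pose B := [set D : {set chord n} | [exists c in D, source c == x]].
rewrite -(cardsID B); congr (_ + _).
  have <- : #|x |: O| = #|O|.+1 by rewrite cardsU1 xO.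
  rewrite -(IH _ _ _ im' (partial_diagram_source (x := x) pd)).
  apply: eq_card => D; rewrite !inE.
  case sD : (single_neighbor D) => //=; have dD : chord_diagram D by case/andP: sD.
  apply/andP/andP.
    case=> /andP[/eqP<- /eqP<-] /exists_inP[c cD /eqP cx].
    by have := open_sources_source dD cD; rewrite cx => -[-> ->].
  case=> /eqP E1 /eqP E2.
  have : x \in open_sources D i.+1 by rewrite E2 setU11.
  case/imsetP => c; rewrite inE => /andP[cD _] xc.
  have := open_sources_source dD cD; rewrite -xc /= E1 E2 => -[<- E].
  rewrite eqxx; split; last by apply/exists_inP; exists c; rewrite // xc.
  rewrite -(setU1K xO) E setU1K ?eqxx //.
  by apply/negP => /imsetP[d]; rewrite inE => /andP[_ /andP[+ _]] => /[swap] <-; rewrite ltnn.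
have sinkx D : D \in completions i P O :\: B ->
   exists2 c, c \in D & sink c = x /\ source c \in O /\ #|[set y in O | source c < y]| = (0 < m).
  rewrite !inE => /andP[nB /and3P[sD _ /eqP EO]].
  have dD : chord_diagram D by case/andP: sD.
  case: (chord_at x dD) => c cD /orP[|/eqP cx].
    by move=> cx; case/negP: nB; apply/exists_inP; exists c.
  exists c => //; split=> //.
  have [_ _] := open_sources_sink dD cD; rewrite cx EO => -> <-; split=> //.
  case/andP: sD => _ /forall_inP/(_ c cD); rewrite -em cx /=.
  case: ltnP => [_ /eqP //|le _]; apply/eqP; rewrite cards_eq0.
  apply/eqP/setP => d; rewrite !inE; apply/negP => /andP[_ /and3P[_ _]].
  by rewrite cx /=; have := ltn_ord (sink d); move: le; clear; lia.
case: ifP => lt; last first.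
  apply/eqP; rewrite cards_eq0; apply/eqP/setP => D; rewrite [RHS]inE.
  apply/negbTE/negP => /sinkx[c _ [_ [cO E]]]; case/negP: lt.
  rewrite -E (cardsD1 (source c) O) cO ltnS; apply: subset_leq_card.
  by apply/subsetP => y; rewrite !inE => /andP[-> cy]; case: eqP cy => // ->; rewrite ltnn.
have [a aO rank] := exists_rank lt.
have -> : #|O|.-1 = #|O :\ a| by rewrite (cardsD1 a O) aO.
have rank' : #|[set y in O | a < y]| = (x < (2 * n).-1) by rewrite em.
rewrite -(IH _ _ _ im' (partial_diagram_sink (x := x) pd aO rank')).
have nP : (a, x) \notin P by apply/negP => /Plt /andP[_]; rewrite ltnn.
apply: eq_card => D; apply/idP/idP => DA.
  have [c cD [cx [cO crank]]] := sinkx D DA.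
  have ca : source c = a by apply: (rank_inj cO aO); rewrite crank.
  have cE : c = (a, x) by rewrite -ca -cx; case: (c).
  move: DA; rewrite !inE => /andP[_ /and3P[sD /eqP EP /eqP EO]].
  have dD : chord_diagram D by case/andP: sD.
  by have [] := open_sources_sink dD cD; rewrite cx ca EO EP cE sD => -> -> _ _; rewrite !eqxx.
move: DA; rewrite !inE => /and3P[sD /eqP EP /eqP EO]; rewrite sD.
have dD : chord_diagram D by case/andP: sD.
have aD : (a, x) \in D.
  have : (a, x) \in closed_chords D i.+1 by rewrite EP setU11.
  by rewrite inE => /andP[].
have [] := open_sources_sink dD aD; rewrite /source /sink /= EP EO => E1 E2 aO' _.
apply/and3P; split=> //=.
- apply/negP => /exists_inP[c cD /eqP cx].
  by apply: (source_neq_sink dD cD aD); rewrite /source cx.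
- rewrite -(setU1K nP) E1 setU1K // inE aD /sink /=; by rewrite ltnn.
- by rewrite -(setD1K aO) E2 setD1K.
Qed.

(** * Ballot numbers and the Catalan number *)

Lemma positive_paths_high k m : m < k -> positive_paths k m = 0.
Proof.
elim: m k => [|m IH] [|k] //= lt; rewrite IH; last by lia.
by case: ifP => // _; rewrite IH.
Qed.

(** The reflection formula C(m, u) - C(m, u-1), stated additively: [u] is the number of up steps,
    and the final step, from 1 to 0, is forced. The proof is by Pascal's rule. *)
Lemma positive_pathsE m u k : m = 2 * u + k ->
  positive_paths k.+1 m.+1 + (if u is u'.+1 then 'C(m, u') else 0) = 'C(m, u).
Proof.
elim: m u k => [|m IH] u k Em; first by case: u k Em => [|u] [|k] //; lia.
rewrite -[positive_paths _ _]/(positive_paths k.+2 m.+1 +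
  (if 1 < k.+1 then positive_paths k m.+1 else 0)).
case: k Em => [|k] Em.
  case: u Em => [|u] Em; first by lia.
  (* At height 1 the path may not step down; here [m] is odd and its two central binomial
     coefficients agree, which makes up for the missing term. *)
  have sym : 'C(m, u.+1) = 'C(m, u) by rewrite -bin_sub; [congr 'C(_, _)|]; lia.
  have := IH u 1 ltac:(lia); rewrite ltnn addn0 binS sym.
  by case: u {Em sym} => [|u]; rewrite ?bin0 ?binS; lia.
have E2 := IH u k ltac:(lia); rewrite (_ : 1 < k.+2) //.
case: u Em E2 => [|u] Em E2.
  by rewrite positive_paths_high; [rewrite !bin0 in E2 *; lia|lia].
have E1 := IH u k.+2 ltac:(lia); rewrite binS -E2.
case: u Em E2 E1 => [|u] Em E2 E1; rewrite ?binS; rewrite ?bin0 in E1 E2 *; lia.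
Qed.

Lemma positive_paths_catalan n : n.+1 * positive_paths 0 (2 * n.+1) = 'C(2 * n, n).
Proof.
have -> : positive_paths 0 (2 * n.+1) = positive_paths 1 (2 * n).+1.
  by rewrite mulnS -[LHS]/(positive_paths 1 (2 * n).+1 + 0) addn0.
have := @positive_pathsE (2 * n) n 0 (esym (addn0 _)).
case: n => [|n]; first by [].
(* With N = n+1 this reads N C(2N, N) = (N+1) C(2N, N-1), which turns the difference of binomials
   into C(2N, N) / (N+1). *)
have := mul_bin_left (2 * n.+1) n; rewrite (_ : 2 * n.+1 - n = n.+2); last by lia.
move: 'C(_, n.+1) 'C(_, n) (positive_paths _ _) => a b h E1 E2.
by apply/eqP; rewrite -(eqn_add2r (n.+2 * b)) -mulnDr E2 -E1 -mulSn.
Qed.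

Lemma card_single_neighbor n :
  #|[set D : {set chord n} | single_neighbor D]| = positive_paths 0 (2 * n).
Proof.
have pd : @partial_diagram n 0 set0 set0 by split=> // c; rewrite inE.
have := card_completions (add0n _) pd; rewrite cards0 => <-.
apply: eq_card => D; rewrite !inE (_ : closed_chords D 0 = set0); last first.
  by apply/setP => c; rewrite !inE andbF.
rewrite (_ : open_sources D 0 = set0) ?eqxx ?andbT //.
by apply/setP => y; rewrite inE; apply/negbTE/negP => /imsetP[c]; rewrite inE andbF.
Qed.

Theorem theorem7p12 (n : nat) (hn : 1 <= n) :
  [set D : {set chord n} |
     [&& chord_diagram D, one_terminal D & ~~ has_top_cycle D]] =
  [set D : {set chord n} |
     [&& chord_diagram D, one_terminal D, ~~ has_top_cycle D
       & ~~ has_bottom_cycle D]] /\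
  (#|[set D : {set chord n} |
     [&& chord_diagram D, one_terminal D & ~~ has_top_cycle D]]|%:R
   = n%:R^-1 * 'C(2 * n - 2, n - 1)%:R :> rat)%R.
Proof.
split.
  apply/setP => D; rewrite !inE -single_neighborP; apply/idP/idP => [sD|].
    have := single_neighbor_no_bottom sD.
    by move: sD; rewrite single_neighborP => /and3P[-> -> ->].
  by rewrite single_neighborP => /and4P[-> -> ->].
have -> : #|[set D : {set chord n} |
     [&& chord_diagram D, one_terminal D & ~~ has_top_cycle D]]| = positive_paths 0 (2 * n).
  by rewrite -card_single_neighbor; apply: eq_card => D; rewrite !inE single_neighborP.
case: n hn => // n _; rewrite mulnS addKn subSS subn0 -mulnS -positive_paths_catalan.
rewrite GRing.natrM GRing.mulrA GRing.mulVf ?GRing.mul1r //.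
by rewrite Num.Theory.pnatr_eq0.
Qed.
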